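(* Let $k,\alpha$ be integers with $k/2<\alpha\le k$ and consider Slush with parameters $k,\alpha$ on $n$ parties, all with opinions in $\{0,1\}$. For every round $i\ge1$, conditioned on the opinions before round $i$, and with $p\in[0,1]$ denoting the fraction of parties holding opinion $1$ before round $i$, the expected relative progress in round $i$ depends only on $p$ (for fixed $k,\alpha$) and equals $$\frac{\mathbb E(\Delta_i)}{n}=\delta(p):=\sum_{\ell=\alpha}^{k}\binom{k}{\ell}\Big[p^\ell(1-p)^{k-\ell+1}-(1-p)^\ell p^{k-\ell+1}\Big],$$ where $\Delta_i=S_i-S_{i-1}$ and $S_j$ is the number of parties with opinion $1$ after round $j$.
   Context: Slush (synchronous, binary): there are $n$ parties, each holding an opinion in $\{0,1\}$. In each round every party independently draws a sample of $k$ parties uniformly at random with repetition from all $n$ parties (independently across parties and rounds) and looks at the opinions held by the sampled parties before the round. If at least $\alpha$ of the $k$ sampled opinions equal $b$, the party adopts opinion $b$; otherwise it keeps its opinion. All updates in a round are simultaneous. $S_0$ is the initial number of parties with opinion $1$. *)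

(* Defs.v *)
From HB Require Import structures.
From mathcomp Require Import all_boot all_order all_algebra.
From mathcomp Require Import finmap.
From mathcomp Require Import all_classical all_reals all_analysis.

Set Implicit Arguments.
Unset Strict Implicit.
Unset Printing Implicit Defensive.

Import Order.TTheory GRing.Theory Num.Theory.

Local Open Scope classical_set_scope.
Local Open Scope ring_scope.

Section Probability.
Context {d : measure_display} {T : measurableType d} {R : realType}.
Implicit Type P : probability T R.

(* Measurability with respect to the discrete sigma-algebra on [E]. *)
Definition discrete_rv (E : finType) (X : T -> E) : Prop :=
  forall B : set E, measurable (X @^-1` B).

Definition uniformly_distributed P (E : finType) (X : T -> E) : Prop :=
  forall a : E, P (X @^-1` [set a]) = ((#|E|%:R : R)^-1)%:E.

(* Mutual independence: the product rule over every finite subfamily. *)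
Definition mutually_independent P (I : choiceType) (E : finType)
    (X : I -> T -> E) : Prop :=
  forall (J : {fset I}) (B : I -> set E),
    P (\bigcap_(i in [set` J]) (X i @^-1` B i)) =
    (\prod_(i <- J) P (X i @^-1` B i))%E.

(* E[X | A] = E[X 1_A] / P(A), meaningful only when P(A) > 0. *)
Definition cond_expectation P (X : T -> R) (A : set T) : \bar R :=
  ('E_P[X \* \1_A] / P A)%E.

End Probability.

Section Slush.
Variables (n k alpha : nat).

(* The opinion of party [v] is [x v]; [true] stands for opinion 1. *)
Definition config := {ffun 'I_n -> bool}.

Definition ones (x : config) : nat := #|[set v | x v]%SET|.

(* [s j] is the [j]-th sampled party; samples are drawn with repetition. *)
Definition votes (x : config) (s : 'I_k -> 'I_n) (b : bool) : nat :=
  #|[set j | x (s j) == b]%SET|.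

(* The order of the two tests is irrelevant when k < 2 * alpha, as then at most
   one opinion can reach the threshold. *)
Definition slush_step (x : config) (s : 'I_n -> 'I_k -> 'I_n) : config :=
  [ffun v => if (alpha <= votes x (s v) true)%N then true
             else if (alpha <= votes x (s v) false)%N then false
             else x v].

Section Process.
Context {d : measure_display} {T : measurableType d} {R : realType}.

(* [U r v j] is the [j]-th party sampled by party [v] in round [r.+1]
   (rounds are numbered from 1). *)
Variable U : nat -> 'I_n -> 'I_k -> T -> 'I_n.

Record slush_samples (P : probability T R) : Prop := SlushSamples {
  slush_samples_rv : forall r v j, discrete_rv (U r v j);
  slush_samples_uniform : forall r v j, uniformly_distributed P (U r v j);
  slush_samples_indep : mutually_independent P
    (fun q : nat * 'I_n * 'I_k => U q.1.1 q.1.2 q.2) }.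

(* Opinions after round [i], starting from [x0]. *)
Fixpoint opinions (x0 : config) (i : nat) (w : T) : config :=
  if i is r.+1 then slush_step (opinions x0 r w) (fun v j => U r v j w)
  else x0.

(* Progress in round [i], for 1 <= i. *)
Definition progress (x0 : config) (i : nat) (w : T) : R :=
  (ones (opinions x0 i w))%:R - (ones (opinions x0 i.-1 w))%:R.

End Process.
End Slush.

Definition delta {R : realType} (k alpha : nat) (p : R) : R :=
  \sum_(alpha <= l < k.+1) 'C(k, l)%:R *
    (p ^+ l * (1 - p) ^+ (k - l + 1) - (1 - p) ^+ l * p ^+ (k - l + 1)).

(* Main.v *)
(* All samples being independent and uniform, the samples of the past rounds
   together with those of party v in the current round are jointly uniform, so
   every probability below is a ratio of cardinals of finite sets. Hence, given
   the current opinions, the k samples of v are still uniform, and the number of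
   sampled opinions 1 is binomial with parameters k and p. As k < 2 * alpha, the
   two thresholds exclude each other: a party of opinion 0 switches with
   probability F(p) and a party of opinion 1 with probability F(1 - p), where F
   is the binomial tail from alpha on. Summing over the parties gives
   n ((1 - p) F(p) - p F(1 - p)) = n delta(p). *)
Require Import Defs.
From HB Require Import structures.
From mathcomp Require Import all_boot all_order all_algebra.
From mathcomp Require Import finmap.
From mathcomp Require Import all_classical all_reals all_analysis.
From mathcomp Require Import zify ring.

Set Implicit Arguments.
Unset Strict Implicit.
Unset Printing Implicit Defensive.

Import Order.TTheory GRing.Theory Num.Theory.

Local Open Scope classical_set_scope.
Local Open Scope ring_scope.

(** * Finitely valued random variables and uniform distributions *)

Section DiscreteVariables.
Context {d : measure_display} {T : measurableType d} {R : realType}.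
Implicit Type P : probability T R.

Lemma discrete_rv_atoms (E : finType) (Z : T -> E) :
  (forall a, measurable (Z @^-1` [set a])) -> discrete_rv Z.
Proof.
move=> mZ B.
have -> : Z @^-1` B = \bigcup_(a in B) Z @^-1` [set a].
  by apply/seteqP; split => [w Bw|w [a /[swap] /= <-//]]; exists (Z w).
exact: fin_bigcup_measurable.
Qed.

Lemma discrete_rv_ffun (J E : finType) (X : J -> T -> E) :
  (forall j, discrete_rv (X j)) ->
  discrete_rv (fun w => [ffun j => X j w] : {ffun J -> E}).
Proof.
move=> mX; apply: discrete_rv_atoms => h.
have -> : (fun w => [ffun j => X j w]) @^-1` [set h] =
    \bigcap_(j in setT) X j @^-1` [set h j].
  apply/seteqP; split => [w <- j _ /=|w hw /=]; first by rewrite ffunE.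
  by apply/ffunP => j; rewrite ffunE; exact: hw.
by apply: fin_bigcap_measurable => // j _; exact: mX.
Qed.

Lemma discrete_rv_pair (E1 E2 : finType) (X : T -> E1) (Y : T -> E2) :
  discrete_rv X -> discrete_rv Y -> discrete_rv (fun w => (X w, Y w)).
Proof.
move=> mX mY; apply: discrete_rv_atoms => -[a b].
have -> : (fun w => (X w, Y w)) @^-1` [set (a, b)] =
    X @^-1` [set a] `&` Y @^-1` [set b].
  by apply/seteqP; split => w /= [<- <-].
by apply: measurableI; [exact: mX | exact: mY].
Qed.

Lemma uniform_probability P (E : finType) (Z : T -> E) (Q : pred E) :
  discrete_rv Z -> uniformly_distributed P Z ->
  P [set w | Q (Z w)] = (#|Q|%:R / #|E|%:R)%:E.
Proof.
move=> mZ uZ.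
have -> : [set w | Q (Z w)] = \bigcup_(a in [set` enum Q]) Z @^-1` [set a].
  apply/seteqP; split => [w /= Qw|w [a /=]].
    by exists (Z w) => //=; rewrite mem_enum.
  by rewrite mem_enum => /[swap] <-.
rewrite measure_fin_bigcup; last 3 first.
- exact: finite_finpred.
- by move=> a b _ _ [w [/= <- <-]].
- by move=> a _; exact: mZ.
rewrite -fsbig_seq ?enum_uniq// (eq_bigr _ (fun a _ => uZ a)) sumEFin.
by rewrite big_const_seq count_predT -cardE iter_addr_0 mulr_natl.
Qed.

(** Since [f] is injective, its image is a finite subfamily of [I] listed once by [J]. The product
    rule over this image gives every array the probability 1/|E| to the power |J|. *)
Lemma uniform_ffun P (I : choiceType) (J E : finType) (X : I -> T -> E)
    (f : J -> I) :
  injective f -> mutually_independent P X ->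
  (forall i, uniformly_distributed P (X i)) ->
  uniformly_distributed P (fun w => [ffun j => X (f j) w] : {ffun J -> E}).
Proof.
move=> finj indX uX h.
(* Independence asks for a set at every index of [I]: this one is the singleton of [h j] at [f j],
   by injectivity, and everything off the image of [f]. *)
pose B i := [set a | forall j, f j = i -> a = h j].
have Bf j : B (f j) = [set h j].
  by apply/seteqP; split => [a /(_ _ erefl)//|a /= -> j' /finj ->].
pose F : {fset I} := seq_fset tt (codom f).
have -> : (fun w => [ffun j => X (f j) w]) @^-1` [set h] =
    \bigcap_(i in [set` F]) (X i @^-1` B i).
  apply/seteqP; split => [w /= Xh i /=|w hw /=].
    by rewrite seq_fsetE => /codomP[j ->]; rewrite Bf/= -Xh ffunE.
  apply/ffunP => j; rewrite ffunE.
  have : (X (f j) @^-1` B (f j)) w by apply: hw; rewrite /= seq_fsetE codom_f.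
  by rewrite Bf.
rewrite indX (perm_big (codom f)); last first.
  apply: perm_trans (seq_fset_perm _ _) _.
  by rewrite undup_id//; exact/injectiveP.
rewrite codomE big_map.
rewrite (eq_bigr (fun=> ((#|E|%:R : R)^-1)%:E)); last first.
  by move=> j _; rewrite Bf uX.
by rewrite prodEFin big_enum prodr_const card_ffun natrX exprVn.
Qed.

(** Two index families with disjoint images glue to one injective family on the sum type, and an
    array over [J1 + J2] is a pair of arrays. *)
Lemma uniform_ffun_pair P (I : choiceType) (J1 J2 E : finType)
    (X : I -> T -> E) (f1 : J1 -> I) (f2 : J2 -> I) :
  injective f1 -> injective f2 -> (forall a b, f1 a != f2 b) ->
  mutually_independent P X -> (forall i, uniformly_distributed P (X i)) ->
  uniformly_distributed P (fun w =>
    ([ffun j => X (f1 j) w] : {ffun J1 -> E},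
     [ffun j => X (f2 j) w] : {ffun J2 -> E})).
Proof.
move=> f1i f2i f12 indX uX [h1 h2].
pose f (j : J1 + J2) := match j with inl a => f1 a | inr b => f2 b end.
have finj : injective f.
  move=> [a|b] [a'|b'] /=.
  - by move/f1i ->.
  - by move/eqP; rewrite (negbTE (f12 _ _)).
  - by move/esym/eqP; rewrite (negbTE (f12 _ _)).
  - by move/f2i ->.
pose h : {ffun J1 + J2 -> E} :=
  [ffun j => match j with inl a => h1 a | inr b => h2 b end].
have := uniform_ffun finj indX uX h.
rewrite card_prod !card_ffun card_sum expnD => <-; congr (P _).
apply/seteqP; split => w /=.
  by move=> [hw1 hw2]; apply/ffunP => -[a|b]; rewrite !ffunE -?hw1 -?hw2 ffunE.
move=> hw; congr (_, _); apply/ffunP => j; rewrite ffunE.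
  by move/ffunP: hw => /(_ (inl j)); rewrite !ffunE.
by move/ffunP: hw => /(_ (inr j)); rewrite !ffunE.
Qed.

End DiscreteVariables.

(** * Counting samples: the binomial tail as a ratio of cardinals *)

(** Fixing the preimage of [A] constrains each coordinate separately, to [A] on [D] and to its
    complement elsewhere, so the count is a product. *)
Lemma card_ffun_preimset (J E : finType) (A : {set E}) (D : {set J}) :
  #|[set s : {ffun J -> E} | [set j | s j \in A]%SET == D]%SET| =
  (#|A| ^ #|D| * #|~: A| ^ (#|J| - #|D|))%N.
Proof.
pose F j : pred E := fun e => (e \in A) == (j \in D).
transitivity #|family F|.
  apply: eq_card => s; rewrite inE; apply/eqP/familyP => [sD j|sF].
    by rewrite unfold_in /F -sD inE.
  by apply/setP => j; rewrite inE; have := sF j; rewrite unfold_in => /eqP.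
rewrite card_family foldrE big_map big_enum (bigID (mem D))/=; congr (_ * _)%N.
  rewrite -prod_nat_const; apply: eq_bigr => j jD; apply: eq_card => e.
  by rewrite unfold_in /F jD eqb_id.
rewrite -(cardsC D) addKn -prod_nat_const; apply: eq_big => [j|j /negbTE jD].
  by rewrite inE.
by apply: eq_card => e; rewrite unfold_in /F jD eqbF_neg inE.
Qed.

(** The functions are sorted by the preimage [D] of [A], then the sets [D] by their cardinal [l];
    there are 'C(|J|, l) of these. *)
Lemma card_ffun_tail (J E : finType) (A : {set E}) (m : nat) :
  #|[set s : {ffun J -> E} | (m <= #|[set j | s j \in A]|)%N]%SET| =
  (\sum_(m <= l < #|J|.+1) 'C(#|J|, l) * (#|A| ^ l * #|~: A| ^ (#|J| - l)))%N.
Proof.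
rewrite -sum1_card.
rewrite (partition_big (fun s : {ffun J -> E} => [set j | s j \in A]%SET)
  (fun D : {set J} => (m <= #|D|)%N)); last by move=> s; rewrite inE.
under eq_bigr => D mD.
  rewrite (eq_bigl (mem [set s : {ffun J -> E} |
    [set j | s j \in A]%SET == D]%SET)); last first.
    by move=> s; rewrite /= !inE; case: eqP => [->|]; rewrite ?mD ?andbF.
  rewrite sum1_card card_ffun_preimset; over.
rewrite big_geq_mkord/=.
rewrite (partition_big (fun D : {set J} => inord #|D| : 'I_#|J|.+1)
  (fun l => m <= l)%N); last first.
  by move=> D mD; rewrite inordK// ltnS max_card.
apply: eq_bigr => l ml.
rewrite (eq_bigl (mem [set D : {set J} | #|D| == l]%SET)); last first.
  move=> D; rewrite /= inE -val_eqE/= inordK ?ltnS ?max_card//.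
  by case: eqP => [->|]; rewrite ?ml ?andbF.
rewrite (eq_bigr (fun=> #|A| ^ l * #|~: A| ^ (#|J| - l)))%N; last first.
  by move=> D; rewrite /= inE => /eqP ->.
by rewrite sum_nat_const card_draws.
Qed.

(** For [p] in [0,1], the probability that a binomial variable with parameters [k] and [p] is at
    least [m]. *)
Definition binomial_tail {R : realType} (k m : nat) (p : R) : R :=
  \sum_(m <= l < k.+1) 'C(k, l)%:R * (p ^+ l * (1 - p) ^+ (k - l)).

Lemma frac_ffun_tail {R : realType} (J E : finType) (A : {set E}) (m : nat) :
  (0 < #|E|)%N ->
  #|[set s : {ffun J -> E} | (m <= #|[set j | s j \in A]|)%N]%SET|%:R /
    #|{ffun J -> E}|%:R = binomial_tail #|J| m (#|A|%:R / #|E|%:R : R).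
Proof.
move=> E0; have En0 : #|E|%:R != 0 :> R by rewrite pnatr_eq0 -lt0n.
rewrite /binomial_tail.
have -> : 1 - #|A|%:R / #|E|%:R = #|~: A|%SET%:R / #|E|%:R :> R.
  apply: (mulIf En0); rewrite mulrBl !mulfVK// mul1r -(cardsC A) natrD.
  by rewrite addrAC subrr add0r.
rewrite card_ffun_tail natr_sum mulr_suml; apply: eq_big_nat => l /andP[_ lk].
rewrite !natrM !natrX card_ffun natrX !expr_div_n mulrACA -invfM -exprD.
by rewrite subnKC// -mulrA.
Qed.

(** The extra 1 in the exponents of [delta] is a factor [1 - p] in the first term and [p] in the
    second; these are the fractions of parties that can switch to 1 and to 0. *)
Lemma deltaE {R : realType} (k alpha : nat) (p : R) :
  delta k alpha p =
  (1 - p) * binomial_tail k alpha p - p * binomial_tail k alpha (1 - p).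
Proof.
rewrite /delta /binomial_tail !mulr_sumr -sumrB; apply: eq_bigr => l _.
by rewrite addn1 !exprS opprB addrCA subrr addr0; ring.
Qed.

(** * One round of Slush from a fixed configuration *)

Section SlushRound.
Context (n k alpha : nat).

Lemma votes_ffun (x : config n) (s : 'I_k -> 'I_n) (b : bool) :
  votes x [ffun j => s j] b = votes x s b.
Proof. by apply: eq_card => j; rewrite !inE ffunE. Qed.

Lemma votesD (x : config n) (s : 'I_k -> 'I_n) :
  (votes x s true + votes x s false = k)%N.
Proof.
rewrite -[RHS]card_ord -(cardsC [set j | x (s j) == true]%SET); congr (_ + _)%N.
by apply: eq_card => j; rewrite !inE; case: (x _).
Qed.

(** The new opinion of [v] depends only on the samples of [v], so a constant family of samples can
    stand for all parties; what results is a predicate on a finite type, ready to be counted. *)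
Definition adopts (x : config n) (v : 'I_n) : pred {ffun 'I_k -> 'I_n} :=
  fun s => slush_step alpha x (fun=> s) v.

Lemma slush_step_adopts (x : config n) (s : 'I_n -> 'I_k -> 'I_n) (v : 'I_n) :
  slush_step alpha x s v = adopts x v [ffun j => s v j].
Proof. by rewrite /adopts !ffunE !votes_ffun. Qed.

Lemma frac_votes {R : realType} (x : config n) (b : bool) : (0 < n)%N ->
  #|[set s : {ffun 'I_k -> 'I_n} | (alpha <= votes x s b)%N]%SET|%:R /
    #|{ffun 'I_k -> 'I_n}|%:R =
  binomial_tail k alpha (#|[set v | x v == b]%SET|%:R / n%:R : R).
Proof.
move=> n0; pose A := [set v | x v == b]%SET.
have := @frac_ffun_tail R 'I_k 'I_n A alpha; rewrite !card_ord => <-//.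
congr (_%:R / _); apply: eq_card => s; rewrite !inE /votes.
by congr (_ <= _)%N; apply: eq_card => j; rewrite !inE.
Qed.

(** A party of opinion 0 ends with opinion 1 exactly when 1 reaches the threshold; a party of
    opinion 1 does so exactly when 0 fails to reach it, whence the complement. *)
Lemma frac_adopts {R : realType} (x : config n) (v : 'I_n) :
  (0 < n)%N -> (k < 2 * alpha)%N -> let p : R := (ones x)%:R / n%:R in
  #|adopts x v|%:R / #|{ffun 'I_k -> 'I_n}|%:R =
  if x v then 1 - binomial_tail k alpha (1 - p) else binomial_tail k alpha p.
Proof.
move=> n0 maj p; have nn0 : n%:R != 0 :> R by rewrite pnatr_eq0 -lt0n.
have -> : p = #|[set v | x v == true]%SET|%:R / n%:R.
  rewrite /p /ones; congr (_%:R / _).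
  by apply: eq_card => u; rewrite !inE eqb_id.
have -> : 1 - #|[set v | x v == true]%SET|%:R / n%:R =
    #|[set v | x v == false]%SET|%:R / n%:R :> R.
  apply: (mulIf nn0); rewrite mulrBl !mulfVK// mul1r -[X in X%:R - _]card_ord.
  rewrite -(cardsC [set v | x v == true]%SET) natrD addrAC subrr add0r.
  by congr _%:R; apply: eq_card => u; rewrite !inE; case: (x u).
rewrite -!frac_votes//.
have Nn0 : #|{ffun 'I_k -> 'I_n}|%:R != 0 :> R.
  by rewrite card_ffun natrX !card_ord expf_neq0.
have [xv|xv] := boolP (x v); last first.
  congr (_%:R / _); apply: eq_card => s.
  rewrite inE unfold_in /adopts ffunE (negbTE xv).
  by case: ifP => //; case: ifP.
apply: (mulIf Nn0); rewrite mulrBl !mulfVK// mul1r.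
rewrite -(cardsC [set s : {ffun 'I_k -> 'I_n} |
  (alpha <= votes x s false)%N]%SET).
rewrite natrD addrAC subrr add0r; congr _%:R.
apply: eq_card => s; rewrite !inE unfold_in /adopts ffunE xv.
(* The two vote counts add up to [k < 2 * alpha], so they cannot both reach [alpha]. *)
have := votesD x s; move: (votes x s true) (votes x s false) => a b abk.
by case: (leqP alpha a); case: (leqP alpha b) => //=; lia.
Qed.

(** * Independence of the current samples from the past *)

Section Process.
Context {d : measure_display} {T : measurableType d} {R : realType}.
Context (U : nat -> 'I_n -> 'I_k -> T -> 'I_n) (P : probability T R).
Context (hU : slush_samples U P) (x0 : config n).

Lemma eq_opinions (r : nat) (w w' : T) :
  (forall q v j, (q < r)%N -> U q v j w = U q v j w') ->
  opinions alpha U x0 r w = opinions alpha U x0 r w'.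
Proof.
elim: r => [//|r IHr] Uw /=; rewrite IHr => [|q v j qr]; last exact/Uw/ltnW.
apply/ffunP => v; rewrite !slush_step_adopts; congr (adopts _ _ _).
by apply/ffunP => j; rewrite !ffunE Uw.
Qed.

Let past (r : nat) (w : T) : {ffun 'I_r * 'I_n * 'I_k -> 'I_n} :=
  [ffun q : 'I_r * 'I_n * 'I_k => U q.1.1 q.1.2 q.2 w].

Let current (r : nat) (v : 'I_n) (w : T) : {ffun 'I_k -> 'I_n} :=
  [ffun j => U r v j w].

(** Turns an event about the process into a predicate on finite arrays of past samples. Any outcome
    [w] realizing the array may serve as witness, as the opinions depend on the array alone. *)
Let past_of (r : nat) (x : config n) : pred {ffun 'I_r * 'I_n * 'I_k -> 'I_n} :=
  fun h => `[< exists2 w, past r w = h & opinions alpha U x0 r w = x >].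

Let past_ofP (r : nat) (x : config n) (w : T) :
  past_of x (past r w) <-> opinions alpha U x0 r w = x.
Proof.
split=> [/asboolP[w' ww' <-]|wx]; last by apply/asboolP; exists w.
apply: eq_opinions => q v j qr.
by move/ffunP: ww' => /(_ (Ordinal qr, v, j)); rewrite !ffunE.
Qed.

Let past_current_rv (r : nat) (v : 'I_n) :
  discrete_rv (fun w => (past r w, current r v w)).
Proof.
by apply: discrete_rv_pair; apply: discrete_rv_ffun => j;
  exact: slush_samples_rv hU _ _ _.
Qed.

Lemma measurable_opinions (r : nat) (x : config n) :
  measurable [set w | opinions alpha U x0 r w = x].
Proof.
have -> : [set w | opinions alpha U x0 r w = x] =
    past r @^-1` [set h | past_of x h].
  by apply/seteqP; split => w /past_ofP.
by apply: discrete_rv_ffun => j; exact: slush_samples_rv hU _ _ _.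
Qed.

Let joint (r : nat) (x : config n) (Q : pred {ffun 'I_k -> 'I_n}) :
    pred ({ffun 'I_r * 'I_n * 'I_k -> 'I_n} * {ffun 'I_k -> 'I_n}) :=
  fun z => past_of x z.1 && Q z.2.

Let past_currentE (r : nat) (v : 'I_n) (x : config n)
    (Q : pred {ffun 'I_k -> 'I_n}) :
  [set w | opinions alpha U x0 r w = x] `&` [set w | Q [ffun j => U r v j w]] =
  [set w | joint x Q (past r w, current r v w)].
Proof.
apply/seteqP; split => w /=.
  by move=> [/past_ofP wx Qw]; apply/andP.
by move=> /andP[/past_ofP wx Qw].
Qed.

Lemma measurable_opinions_samples (r : nat) (v : 'I_n) (x : config n)
    (Q : pred {ffun 'I_k -> 'I_n}) :
  measurable ([set w | opinions alpha U x0 r w = x] `&`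
              [set w | Q [ffun j => U r v j w]]).
Proof.
rewrite past_currentE.
exact: (@past_current_rv r v [set z | joint x Q z]).
Qed.

(** Past and current samples are jointly uniform on a product of finite sets, in which the event is
    a rectangle, so its probability is a product of two ratios. *)
Lemma opinions_samples_indep (r : nat) (v : 'I_n) (x : config n)
    (Q : pred {ffun 'I_k -> 'I_n}) :
  P ([set w | opinions alpha U x0 r w = x] `&`
     [set w | Q [ffun j => U r v j w]]) =
  (P [set w | opinions alpha U x0 r w = x] *
   (#|Q|%:R / #|{ffun 'I_k -> 'I_n}|%:R)%:E)%E.
Proof.
have uXY : uniformly_distributed P (fun w => (past r w, current r v w)).
  apply: (@uniform_ffun_pair _ _ _ P (nat * 'I_n * 'I_k)%type
    ('I_r * 'I_n * 'I_k)%type 'I_k 'I_n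
    (fun q => U q.1.1 q.1.2 q.2)
    (fun q => (q.1.1 : nat, q.1.2, q.2)) (fun j => (r, v, j))).
  - by move=> [[a b] c] [[a' b'] c'] [/val_inj -> -> ->].
  - by move=> j j' [].
  (* Past samples carry a round index below [r], the current ones the index [r]. *)
  - move=> [[a b] c] j; apply/eqP => -[ar _ _].
    by have := ltn_ord a; rewrite ar ltnn.
  - exact: slush_samples_indep hU.
  - by move=> q; exact: slush_samples_uniform hU _ _ _.
have PQ (Q' : pred {ffun 'I_k -> 'I_n}) :
    P ([set w | opinions alpha U x0 r w = x] `&`
       [set w | Q' [ffun j => U r v j w]]) =
    (#|past_of (r := r) x|%:R / #|{ffun 'I_r * 'I_n * 'I_k -> 'I_n}|%:R *
     (#|Q'|%:R / #|{ffun 'I_k -> 'I_n}|%:R))%:E.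
  rewrite past_currentE (uniform_probability _ (@past_current_rv r v) uXY).
  rewrite (eq_card (B := [predX past_of (r := r) x & Q'])) => [|z]; last first.
    by rewrite !inE.
  by rewrite cardX card_prod !natrM invfM mulrACA.
(* With [predT] as second side, the rectangle formula also evaluates the probability of the past
   event. *)
have AT : [set w | opinions alpha U x0 r w = x] =
    [set w | opinions alpha U x0 r w = x] `&`
    [set w | predT [ffun j => U r v j w]].
  by apply/seteqP; split => // w [].
rewrite PQ [X in (P X * _)%E]AT PQ.
have Nn0 : #|{ffun 'I_k -> 'I_n}|%:R != 0 :> R.
  rewrite pnatr_eq0 -lt0n; by apply/card_gt0P; exists [ffun=> v].
by rewrite divff// mulr1 -EFinM.
Qed.

End Process.
End SlushRound.

(** * Conditional expectation of the progress *)

Lemma Lfun1_indic {d : measure_display} {T : measurableType d} {R : realType}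
    (P : probability T R) (A : set T) :
  measurable A -> (\1_A : T -> R) \in Lfun P 1.
Proof. by move=> mA; apply/Lfun1_integrable; exact: integrable_indic. Qed.

Lemma expectation_indic_comb {d : measure_display} {T : measurableType d}
    {R : realType} (P : probability T R) (I : finType) (B : I -> set T)
    (A : set T) (c : I -> R) :
  (forall i, measurable (B i)) -> measurable A ->
  ('E_P[fun w => (\sum_i (\1_(B i) w - c i * \1_A w))%R])%E =
  (\sum_i (fine (P (B i)) - c i * fine (P A)))%:E.
Proof.
move=> mB mA; pose X i : T -> R := \1_(B i) \- (c i \o* \1_A).
have LcA i : (c i \o* \1_A : T -> R) \in Lfun P 1.
  exact/Lfun_scale/Lfun1_indic.
have LX i : X i \in Lfun P 1 by rewrite rpredB// Lfun1_indic.
have -> : (fun w => \sum_i (\1_(B i) w - c i * \1_A w)) =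
    \sum_(f <- [seq X i | i : I]) f.
  apply/funext => w; rewrite big_map big_enum fct_sumE.
  by apply: eq_bigr => i _; rewrite /X /= [_ * c i]mulrC.
rewrite expectation_sum => [|f /mapP[i _ ->]//].
rewrite big_map big_enum -sumEFin; apply: eq_bigr => i _.
rewrite expectationB ?expectationZl ?Lfun1_indic// !expectation_indic//.
by rewrite EFinB EFinM !fineK ?fin_num_measure.
Qed.

Theorem lemma3p1 (R : realType) (n k alpha : nat)
  (hn : (0 < n)%N) (hmaj : (k < 2 * alpha)%N) (hk : (alpha <= k)%N)
  (d : measure_display) (T : measurableType d) (P : probability T R)
  (U : nat -> 'I_n -> 'I_k -> T -> 'I_n) (hU : slush_samples U P)
  (x0 : config n) (i : nat) (hi : (1 <= i)%N) (x : config n)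
  (hx : (0 < P [set w | opinions alpha U x0 i.-1 w = x])%E) :
  let p : R := (ones x)%:R / n%:R in
  (cond_expectation P (progress alpha U x0 i)
     [set w | opinions alpha U x0 i.-1 w = x] / (n%:R)%:E)%E =
  (delta k alpha p)%:E.
Proof.
move=> p; rewrite /cond_expectation; case: i hi hx => [//|r] _ /= hA.
set A := [set w | _] in hA *.
(* The event that the configuration before the round is [x] and [v] holds opinion 1 after it. *)
pose B v := A `&` [set w | adopts alpha x v [ffun j => U r v j w]].
(* Off [A] both sides vanish; on [A] the old opinions are the constants [x v], and [B v] records the
   new opinion of [v]. *)
have -> : progress alpha U x0 r.+1 \* \1_A =
    (fun w => \sum_v (\1_(B v) w - (x v)%:R * \1_A w)) :> (T -> R).
  apply/funext => w; rewrite /= /progress /= sumrB -mulr_suml.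
  have -> : \sum_v (x v)%:R = (ones x)%:R :> R.
    rewrite /ones -sum1_card [in RHS]big_mkcond natr_sum; apply: eq_bigr => v _.
    by rewrite inE; case: (x v).
  have [wA|wA] := pselect (A w); last first.
    rewrite [\1_A w]indicE memNset// !mulr0 subr0 big1// => v _.
    by rewrite indicE memNset// => -[].
  rewrite [\1_A w]indicE mem_set// !mulr1 (_ : opinions _ _ _ r w = x)//.
  congr (_ - _); rewrite /ones -sum1_card [in LHS]big_mkcond natr_sum.
  apply: eq_bigr => v _; rewrite inE slush_step_adopts indicE.
  have -> : (w \in B v) = adopts alpha x v [ffun j => U r v j w].
    by apply/idP/idP => [/set_mem[]|Qw]//; apply/mem_set.
  by case: adopts.
rewrite expectation_indic_comb; last 2 first.
- by move=> v; exact: measurable_opinions_samples hU _ _ _ _ _.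
- exact: measurable_opinions hU _ _ _.
set a := fine (P A); have PA : P A = a%:E.
  by rewrite fineK ?fin_num_measure//; exact: measurable_opinions hU _ _ _.
have a0 : a != 0 by move: hA; rewrite PA lte_fin => /lt0r_neq0.
have nn0 : n%:R != 0 :> R by rewrite pnatr_eq0 -lt0n.
have EB v : fine (P (B v)) = a * (if x v then 1 - binomial_tail k alpha (1 - p)
    else binomial_tail k alpha p).
  by rewrite /B (opinions_samples_indep alpha hU x0) -/A PA -frac_adopts.
(* As [a] and [n] are nonzero, both extended real divisions are real ones. *)
rewrite PA !inver (negbTE a0) (negbTE nn0) -!EFinM; congr _%:E.
rewrite (eq_bigr _ (fun v _ => congr1 (fun y => y - _) (EB v))).
(* Grouped by old opinion, each party of opinion 1 contributes -a F(1 - p) and each party of opinion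
   0 contributes a F(p); there are p n and (1 - p) n of them. *)
rewrite (bigID x)/=.
rewrite (eq_bigr (fun=> a * - binomial_tail k alpha (1 - p))); last first.
  by move=> v -> /=; ring.
rewrite [X in _ + X](eq_bigr (fun=> a * binomial_tail k alpha p)); last first.
  by move=> v /negbTE -> /=; ring.
rewrite !sumr_const deltaE.
have c1 : #|[pred v | x v]|%:R = p * n%:R.
  by rewrite /p mulfVK//; congr _%:R; apply: eq_card => v; rewrite inE.
have c0 : #|[pred v | ~~ x v]|%:R = (1 - p) * n%:R :> R.
  apply/eqP; rewrite mulrBl mul1r -c1 eq_sym subr_eq -natrD addnC.
  by rewrite (cardC [pred v | x v]) card_ord.
rewrite -[X in X + _]mulr_natl -[X in _ + X]mulr_natl c1 c0.
clearbody p a; move: (binomial_tail k alpha) => F.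
by field; rewrite nn0.
Qed.
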